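(* Suppose that the Lipschitz/boundedness assumption in the context holds for the constrained convex problem (P) and that $(x^*,y^*,z^* )$ is a KKT point of (P). Let $\{w^k\}=\{(x^k,y^k,z^k)\}$ be the sequence generated by the linearized augmented Lagrangian method (LALM, described in the context) with any $x^0$, $y^0=0$ and $z^0=0$. If $\rho_y,\rho_z\in(0,\beta]$, then for every $k\ge0$, $$|f_0(\bar x^{k+1})-f_0(x^* )|\le\frac{\eta^\infty}{\eta^0(k+1)}\left(\frac{\eta^0}2\|x^0-x^*\|^2+\frac{2\|y^*\|^2}{\rho_y}+\sum_{j=1}^m\frac{2(z_j^* )^2}{\rho_z}\right),$$ $$\|A\bar x^{k+1}-b\|+\sum_{j=1}^m[f_j(\bar x^{k+1})]_+\le\frac{\eta^\infty}{\eta^0(k+1)}\left(\frac{\eta^0}2\|x^0-x^*\|^2+\frac{(1+\|y^*\|)^2}{2\rho_y}+\sum_{j=1}^m\frac{(1+z_j^* )^2}{2\rho_z}\right),$$ where $\bar x^{k+1}=\frac{\sum_{t=0}^k x^{t+1}/\eta^t}{\sum_{t=0}^k1/\eta^t}$ and $\eta^\infty\le\bar\eta$ is the limit of $\{\eta^k\}$, with $\bar\eta$ a constant satisfying the inequality $(\star)$ of the context.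
   Context: Problem (P): $\min_{x\in\mathbb R^p} f_0(x):=g(x)+h(x)$ subject to $Ax=b$, $f_j(x)\le 0$ for $j=1,\dots,m$, where $A\in\mathbb R^{q\times p}$, $b\in\mathbb R^q$, $g,f_1,\dots,f_m:\mathbb R^p\to\mathbb R$ are convex and differentiable with Lipschitz gradients, and $h:\mathbb R^p\to(-\infty,+\infty]$ is proper, closed and convex (possibly nondifferentiable). $\|\cdot\|$ is the Euclidean norm (spectral norm for matrices); $[a]_+=\max(0,a)$. KKT point: $w=(x,y,z)\in\mathbb R^p\times\mathbb R^q\times\mathbb R^m$ is a KKT point of (P) if $0\in\nabla g(x)+\partial h(x)+A^\top y+\sum_{j=1}^m z_j\nabla f_j(x)$, $Ax=b$, and $z_j\ge0$, $f_j(x)\le0$, $z_jf_j(x)=0$ for all $j$. Lipschitz/boundedness assumption: there are constants $L_g,L_1,\dots,L_m$ and $B_1,\dots,B_m$ such that for all $\hat x,\tilde x\in\mathrm{dom}(h)$ and all $j$: $\|\nabla g(\hat x)-\nabla g(\tilde x)\|\le L_g\|\hat x-\tilde x\|$, $\|\nabla f_j(\hat x)-\nabla f_j(\tilde x)\|\le L_j\|\hat x-\tilde x\|$, and $\|\nabla f_j(\hat x)\|\le B_j$. Augmented Lagrangian: for a penalty parameter $\beta>0$, let $\psi_\beta(u,v)=uv+\frac\beta2u^2$ if $\beta u+v\ge0$ and $\psi_\beta(u,v)=-\frac{v^2}{2\beta}$ if $\beta u+v<0$; $\Psi_\beta(x,z)=\sum_{j=1}^m\psi_\beta(f_j(x),z_j)$;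 and $F_\beta(x,y,z)=g(x)+y^\top(Ax-b)+\frac\beta2\|Ax-b\|^2+\Psi_\beta(x,z)$. LALM: given parameters $\beta,\rho_y,\rho_z>0$, $\delta\ge0$ and an initial point $w^0=(x^0,y^0,z^0)$, set $\eta^{-1}=0$. For $k=0,1,\dots$, let $L_F^k=L_g+\beta\|A\|^2+\sum_{j=1}^m\big(\beta B_j^2+L_j[\beta f_j(x^k)+z_j^k]_+\big)$, $\eta^k=\max(\eta^{k-1},L_F^k+\delta)$, and $$x^{k+1}=\arg\min_x\; h(x)+\langle\nabla_xF_\beta(w^k),x\rangle+\frac{\eta^k}2\|x-x^k\|^2,$$ $$y^{k+1}=y^k+\rho_y(Ax^{k+1}-b),\qquad z_j^{k+1}=z_j^k+\rho_z\max\Big(-\frac{z_j^k}\beta,f_j(x^{k+1})\Big),\ j=1,\dots,m.$$ Inequality $(\star)$ for a constant $\bar\eta$: $$\bar\eta\ge\delta+L_g+\beta\|A\|^2+\beta\sum_{j=1}^mB_j^2+\beta\sum_{j=1}^mB_jL_j\left(\|x^0-x^*\|+\frac{\|y^0-y^*\|}{\sqrt{\rho_y\eta^0}}+\frac{\|z^0-z^*\|}{\sqrt{\rho_z\eta^0}}\right)$$ $$\qquad+\sqrt{\sum_{j=1}^mL_j^2}\left(\sqrt{\rho_z\bar\eta}\,\|x^0-x^*\|+\sqrt{\frac{\rho_z\bar\eta}{\rho_y\eta^0}}\,\|y^0-y^*\|+\|z^*\|+\max\Big(1,\sqrt{\frac{\bar\eta}{\eta^0}}\Big)\|z^0-z^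*\|\right).$$
   Formalization: The initial point x^0 is taken in dom(h), since the Lipschitz constants are assumed only on dom(h) and the bounds can fail for x^0 outside it; also η^0 > 0 is assumed so that 1/η^t is defined, and L_g, L_j ≥ 0. *)

(* Defs.v *)
From HB Require Import structures.
From mathcomp Require Import all_boot all_order all_algebra.
From mathcomp Require Import all_classical all_reals all_analysis.

Set Implicit Arguments.
Unset Strict Implicit.
Unset Printing Implicit Defensive.

Import Order.TTheory GRing.Theory Num.Theory.
Import numFieldNormedType.Exports.

Local Open Scope classical_set_scope.
Local Open Scope ring_scope.

(* The library's norm on 'cV[R]_n is the sup norm.  It induces the same       *)
(* topology and the same differentials as the Euclidean norm below, which is  *)
(* the one used for all quantitative estimates.                               *)
Definition dotp (R : realType) (n : nat) (u v : 'cV[R]_n) : R :=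
  \sum_(i < n) u i 0 * v i 0.

Definition norm2 (R : realType) (n : nat) (u : 'cV[R]_n) : R :=
  Num.sqrt (dotp u u).

Definition spectral_norm (R : realType) (q p : nat) (A : 'M[R]_(q, p)) : R :=
  sup [set norm2 (A *m u) | u in [set u : 'cV[R]_p | norm2 u <= 1]].

Definition pospart (R : realType) (a : R) : R := Num.max 0 a.

Definition grad (R : realType) (n : nat) (phi : 'cV[R]_n -> R)
    (x : 'cV[R]_n) : 'cV[R]_n :=
  \col_(i < n) 'D_(delta_mx i 0) phi x.

Definition grad_lipschitz_on (R : realType) (n : nat) (D : set 'cV[R]_n)
    (L : R) (phi : 'cV[R]_n -> R) : Prop :=
  forall u v, D u -> D v ->
    norm2 (grad phi u - grad phi v) <= L * norm2 (u - v).

Definition smooth_convex (R : realType) (n : nat)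
    (phi : 'cV[R]_n -> R) : Prop :=
  [/\ convex_function (setT : set (convex_lmodType 'cV[R]_n)) phi,
      forall x, differentiable phi x
    & exists L, grad_lipschitz_on setT L phi].

Section extended_valued.
Context (R : realType) (n : nat).
Implicit Types (h phi : 'cV[R]_n -> \bar R) (x v : 'cV[R]_n).
Local Open Scope ereal_scope.

Definition edom h : set 'cV[R]_n := [set x | h x < +oo].

Definition proper_fun h : Prop := (forall x, -oo < h x) /\ edom h !=set0.

Definition closed_fun h : Prop :=
  closed [set xr : 'cV[R]_n * R | h xr.1 <= xr.2%:E].

(* Intended for functions that avoid -oo; there 0 * +oo = 0 makes the cases   *)
(* t = 0 and t = 1 trivial.                                                   *)
Definition econvex_fun h : Prop := forall x v (t : R), (0 <= t <= 1)%R ->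
  h (t *: x + (1 - t) *: v)%R <= t%:E * h x + (1 - t)%:E * h v.

Definition subdiff h x : set 'cV[R]_n :=
  [set v | forall u, h x + (dotp v (u - x))%:E <= h u].

Definition is_argmin phi x : Prop := forall u, phi x <= phi u.

End extended_valued.

Record program (R : realType) (p q m : nat) := Program {
  pg : 'cV[R]_p -> R ;
  ph : 'cV[R]_p -> \bar R ;
  pf : 'I_m -> 'cV[R]_p -> R ;
  pA : 'M[R]_(q, p) ;
  pb : 'cV[R]_q ;
  pg_smooth : smooth_convex pg ;
  pf_smooth : forall j, smooth_convex (pf j) ;
  ph_proper : proper_fun ph ;
  ph_closed : closed_fun ph ;
  ph_convex : econvex_fun ph }.

Section program_theory.
Context (R : realType) (p q m : nat) (P : program R p q m).
Implicit Types (x : 'cV[R]_p) (y : 'cV[R]_q) (z : 'cV[R]_m).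

Let A := pA P.
Let b := pb P.

Definition f0 x : \bar R := ((pg P x)%:E + ph P x)%E.

Definition is_KKT x y z : Prop :=
  [/\ exists2 v, subdiff (ph P) x v &
        0 = grad (pg P) x + v + A^T *m y + \sum_j z j 0 *: grad (pf P j) x,
      A *m x = b
    & forall j, [/\ 0 <= z j 0, pf P j x <= 0 & z j 0 * pf P j x = 0]].

(* The sign conditions are part of what a Lipschitz constant is; they matter  *)
(* when the domain of h is a singleton.                                       *)
Definition lipschitz_bounded (Lg : R) (L B : 'I_m -> R) : Prop :=
  [/\ 0 <= Lg, forall j, 0 <= L j,
      grad_lipschitz_on (edom (ph P)) Lg (pg P),
      forall j, grad_lipschitz_on (edom (ph P)) (L j) (pf P j)
    & forall j x, edom (ph P) x -> norm2 (grad (pf P j) x) <= B j].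

Definition psi (beta u v : R) : R :=
  if 0 <= beta * u + v then u * v + beta / 2 * u ^+ 2
  else - (v ^+ 2 / (2 * beta)).

Definition Psi (beta : R) x z : R := \sum_j psi beta (pf P j x) (z j 0).

Definition Fbeta (beta : R) x y z : R :=
  pg P x + dotp y (A *m x - b) + beta / 2 * norm2 (A *m x - b) ^+ 2
  + Psi beta x z.

Definition LF (Lg : R) (L B : 'I_m -> R) (beta : R) x z : R :=
  Lg + beta * spectral_norm A ^+ 2
  + \sum_j (beta * B j ^+ 2 + L j * pospart (beta * pf P j x + z j 0)).

Record is_LALM (Lg : R) (L B : 'I_m -> R) (beta rhoy rhoz delta : R)
    (x : nat -> 'cV[R]_p) (y : nat -> 'cV[R]_q) (z : nat -> 'cV[R]_m)
    (eta : nat -> R) : Prop := IsLALM {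
  LALM_eta : forall k, eta k =
    Num.max (if k is k'.+1 then eta k' else 0)
            (LF Lg L B beta (x k) (z k) + delta) ;
  LALM_x : forall k, is_argmin
    (fun u => ph P u
      + (dotp (grad (fun v => Fbeta beta v (y k) (z k)) (x k)) u
         + eta k / 2 * norm2 (u - x k) ^+ 2)%:E)%E
    (x k.+1) ;
  LALM_y : forall k, y k.+1 = y k + rhoy *: (A *m x k.+1 - b) ;
  LALM_z : forall k j, z k.+1 j 0 =
    z k j 0 + rhoz * Num.max (- (z k j 0 / beta)) (pf P j (x k.+1)) }.

Definition star_ineq (Lg : R) (L B : 'I_m -> R) (beta rhoy rhoz delta : R)
    (x0 : 'cV[R]_p) (y0 : 'cV[R]_q) (z0 : 'cV[R]_m) (eta0 : R)
    (xs : 'cV[R]_p) (ys : 'cV[R]_q) (zs : 'cV[R]_m) (etabar : R) : Prop :=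
  delta + Lg + beta * spectral_norm A ^+ 2 + beta * \sum_j B j ^+ 2
  + beta * (\sum_j B j * L j)
    * (norm2 (x0 - xs) + norm2 (y0 - ys) / Num.sqrt (rhoy * eta0)
       + norm2 (z0 - zs) / Num.sqrt (rhoz * eta0))
  + Num.sqrt (\sum_j L j ^+ 2)
    * (Num.sqrt (rhoz * etabar) * norm2 (x0 - xs)
       + Num.sqrt (rhoz * etabar / (rhoy * eta0)) * norm2 (y0 - ys)
       + norm2 zs
       + Num.max 1 (Num.sqrt (etabar / eta0)) * norm2 (z0 - zs))
  <= etabar.

End program_theory.

Definition ergodic (R : realType) (p : nat) (eta : nat -> R)
    (x : nat -> 'cV[R]_p) (k : nat) : 'cV[R]_p :=
  (\sum_(t < k.+1) (eta t)^-1)^-1 *: \sum_(t < k.+1) (eta t)^-1 *: x t.+1.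

(* Main.v *)
(* Test the optimality of x^{k+1} against a feasible point u.  Combined with  *)
(* the descent inequality (valid with the constant L_F^k, since the penalty   *)
(* psi is convex with a nonnegative beta-Lipschitz slope) and the tangent     *)
(* inequality for the convex F_beta, this gives, for all v and all w >= 0,    *)
(*   Lag(x^{k+1}, v, w) - f_0(u) + eta^k/2 |x^{k+1} - u|^2 + E_{k+1}          *)
(*     <= eta^k/2 |x^k - u|^2 + E_k,                                          *)
(* where E_k = |y^k - v|^2/(2 rho_y) + |z^k - w|^2/(2 rho_z): the multiplier  *)
(* updates turn the augmented terms into differences of E because             *)
(* rho_y, rho_z <= beta.  Dividing by eta^k, which is nondecreasing, the      *)
(* right-hand sides telescope.  At a KKT triple (xs, ys, zs) the Lagrangian   *)
(* gap is nonnegative, so the iterates stay at bounded distance from it, and  *)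
(* this bounds L_F^k and hence eta^k by induction on k.  Jensen's inequality  *)
(* at the ergodic point with (v, w) = (0, 0) and (2 ys, 2 zs) gives the       *)
(* objective bound; with v = ys + r/|r|, r being the residual, and            *)
(* w_j = zs_j + [f_j > 0] it gives the feasibility bound.                     *)
Require Import Defs.
From mathcomp Require Import all_boot all_order all_algebra.
From mathcomp Require Import all_classical all_reals all_analysis.
From mathcomp Require Import ring lra.

Import Order.TTheory GRing.Theory Num.Theory.
Import numFieldNormedType.Exports.

Local Open Scope classical_set_scope.
Local Open Scope ring_scope.

Set Implicit Arguments.
Unset Strict Implicit.
Unset Printing Implicit Defensive.

(** * Euclidean inner product and norm *)

(** The core is the one-step inequality [LALM_step], in which the multipliers [v] and [w >= 0] stay
    free. It combines prox optimality with its strong-convexity gain ([argmin_prox_le]), the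
    majorant and the minorant of the augmented Lagrangian ([Fbeta_descent], [Fbeta_ge_tangent]), and
    the expansions of the dual energies ([equality_multiplier_step], [inequality_multiplier_step]).
    Its telescoped sum [LALM_sum] is used twice. At the KKT multipliers all gaps are nonnegative
    ([KKT_lagrangian_ge]), so the iterates stay near the KKT point ([KKT_distance]). This closes a
    self-referential bound on [eta]: the next value is controlled by the square root of the current
    one ([LF_bound], [eta_le]). For other multipliers Jensen's inequality gives
    [ergodic_lagrangian], and suitable choices of [v] and [w] turn it into the two rates. *)

Section euclidean.
Context (R : realType).

Lemma dotpC n (u v : 'cV[R]_n) : dotp u v = dotp v u.
Proof. by apply: eq_bigr => i _; rewrite mulrC. Qed.

Lemma dotpDl n (u v w : 'cV[R]_n) : dotp (u + v) w = dotp u w + dotp v w.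
Proof.
by rewrite /dotp -big_split; apply: eq_bigr => i _; rewrite mxE mulrDl.
Qed.

Lemma dotpDr n (u v w : 'cV[R]_n) : dotp w (u + v) = dotp w u + dotp w v.
Proof. by rewrite !(dotpC w) dotpDl. Qed.

Lemma dotpZl n a (u v : 'cV[R]_n) : dotp (a *: u) v = a * dotp u v.
Proof.
by rewrite /dotp big_distrr /=; apply: eq_bigr => i _; rewrite mxE mulrA.
Qed.

Lemma dotpZr n a (u v : 'cV[R]_n) : dotp v (a *: u) = a * dotp v u.
Proof. by rewrite !(dotpC v) dotpZl. Qed.

Lemma dotpNl n (u v : 'cV[R]_n) : dotp (- u) v = - dotp u v.
Proof. by rewrite -scaleN1r dotpZl mulN1r. Qed.

Lemma dotpNr n (u v : 'cV[R]_n) : dotp v (- u) = - dotp v u.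
Proof. by rewrite !(dotpC v) dotpNl. Qed.

Lemma dotp0l n (v : 'cV[R]_n) : dotp 0 v = 0.
Proof. by rewrite -[0](scale0r v) dotpZl mul0r. Qed.

Lemma dotp_suml n (I : Type) (r : seq I) (u : I -> 'cV[R]_n) (v : 'cV[R]_n) :
  dotp (\sum_(i <- r) u i) v = \sum_(i <- r) dotp (u i) v.
Proof.
by apply: (big_morph (fun w => dotp w v)) => [? ?|]; rewrite (dotpDl, dotp0l).
Qed.

Lemma dotp_trmx p q (A : 'M[R]_(q, p)) (y : 'cV[R]_q) (u : 'cV[R]_p) :
  dotp (A^T *m y) u = dotp y (A *m u).
Proof.
rewrite /dotp.
under eq_bigr do rewrite mxE big_distrl /=.
under [in RHS]eq_bigr do rewrite mxE big_distrr /=.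
rewrite exchange_big; apply: eq_bigr => i _; apply: eq_bigr => j _.
by rewrite mxE mulrCA mulrA.
Qed.

Lemma dotp_delta n (u : 'cV[R]_n) i : dotp u (delta_mx i 0) = u i 0.
Proof.
rewrite /dotp (bigD1 i) //= big1 ?addr0; last first.
  by move=> j ji; rewrite mxE (negbTE ji) mulr0.
by rewrite mxE !eqxx mulr1.
Qed.

Lemma dotp_ge0 n (u : 'cV[R]_n) : 0 <= dotp u u.
Proof. by apply: sumr_ge0 => i _; rewrite -expr2 sqr_ge0. Qed.

Lemma norm2_sqr n (u : 'cV[R]_n) : norm2 u ^+ 2 = dotp u u.
Proof. by rewrite sqr_sqrtr ?dotp_ge0. Qed.

Lemma norm2_ge0 n (u : 'cV[R]_n) : 0 <= norm2 u.
Proof. exact: sqrtr_ge0. Qed.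

Lemma norm2_eq0 n (u : 'cV[R]_n) : norm2 u = 0 -> u = 0.
Proof.
move=> /eqP; rewrite sqrtr_eq0 => u0.
have {u0} /eqP : dotp u u = 0 by apply/le_anti; rewrite u0 dotp_ge0.
rewrite psumr_eq0 => [|i _]; last by rewrite -expr2 sqr_ge0.
move=> /allP u0; apply/colP => i; rewrite mxE.
by have := u0 i (mem_index_enum _); rewrite /= mulf_eq0 orbb => /eqP.
Qed.

Lemma norm2Z n a (u : 'cV[R]_n) : norm2 (a *: u) = `|a| * norm2 u.
Proof.
by rewrite /norm2 dotpZl dotpZr mulrA -expr2 sqrtrM ?sqr_ge0// sqrtr_sqr.
Qed.

Lemma norm2N n (u : 'cV[R]_n) : norm2 (- u) = norm2 u.
Proof. by rewrite -scaleN1r norm2Z normrN1 mul1r. Qed.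

Lemma norm2_0 n : norm2 (0 : 'cV[R]_n) = 0.
Proof. by rewrite /norm2 dotp0l sqrtr0. Qed.

Lemma norm2_sqrB n (u v : 'cV[R]_n) :
  norm2 (u - v) ^+ 2 = norm2 u ^+ 2 - 2 * dotp u v + norm2 v ^+ 2.
Proof.
rewrite !norm2_sqr dotpDl !dotpDr !dotpNl !dotpNr (dotpC v u); ring.
Qed.

Lemma norm2_sqrD n (u v : 'cV[R]_n) :
  norm2 (u + v) ^+ 2 = norm2 u ^+ 2 + 2 * dotp u v + norm2 v ^+ 2.
Proof. rewrite !norm2_sqr dotpDl !dotpDr (dotpC v u); ring. Qed.

Lemma cauchy_schwarz n (u v : 'cV[R]_n) : `|dotp u v| <= norm2 u * norm2 v.
Proof.
have [v0|v0] := eqVneq (norm2 v) 0.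
  by rewrite (norm2_eq0 v0) dotpC dotp0l normr0 mulr_ge0 ?norm2_ge0.
have vgt0 : 0 < norm2 v by rewrite lt_def v0 norm2_ge0.
rewrite -ler_sqr ?nnegrE ?normr_ge0 ?mulr_ge0 ?norm2_ge0//.
rewrite real_normK ?num_real// exprMn.
have := sqr_ge0 (norm2 (norm2 v ^+ 2 *: u - dotp u v *: v)).
rewrite norm2_sqrB !norm2Z dotpZl dotpZr !exprMn !real_normK ?num_real//.
rewrite -[leRHS](_ : norm2 v ^+ 2 *
  (norm2 u ^+ 2 * norm2 v ^+ 2 - dotp u v ^+ 2) = _); last by ring.
by rewrite pmulr_rge0 ?exprn_gt0// subr_ge0.
Qed.

Lemma dotp_le n (u v : 'cV[R]_n) : dotp u v <= norm2 u * norm2 v.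
Proof. exact: le_trans (ler_norm _) (cauchy_schwarz _ _). Qed.

Lemma norm2D n (u v : 'cV[R]_n) : norm2 (u + v) <= norm2 u + norm2 v.
Proof.
rewrite -ler_sqr ?nnegrE ?addr_ge0 ?norm2_ge0// norm2_sqrD.
have := dotp_le u v; lra.
Qed.

(** A crude Frobenius bound, which shows that the set whose [sup] is [spectral_norm A] is bounded
    above; otherwise [sup] would be a default value. *)
Lemma norm2_mulmx_bounded p q (A : 'M[R]_(q, p)) (u : 'cV[R]_p) :
  norm2 (A *m u) <=
    Num.sqrt (\sum_i norm2 (row i A)^T ^+ 2) * norm2 u.
Proof.
rewrite -ler_sqr ?nnegrE ?mulr_ge0 ?norm2_ge0 ?sqrtr_ge0// exprMn.
rewrite [leLHS]norm2_sqr [X in _ <= X * _]sqr_sqrtr; last first.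
  by apply: sumr_ge0 => i _; exact: sqr_ge0.
rewrite mulr_suml; apply: ler_sum => i _.
have -> : (A *m u) i 0 = dotp (row i A)^T u.
  by rewrite mxE; apply: eq_bigr => j _; rewrite !mxE.
rewrite -expr2 -exprMn -real_normK ?num_real// ler_sqr ?nnegrE//.
  exact: cauchy_schwarz.
by rewrite mulr_ge0 ?norm2_ge0.
Qed.

Lemma norm2_mulmx p q (A : 'M[R]_(q, p)) (u : 'cV[R]_p) :
  norm2 (A *m u) <= spectral_norm A * norm2 u.
Proof.
have [u0|u0] := eqVneq (norm2 u) 0.
  by rewrite (norm2_eq0 u0) mulmx0 !norm2_0 mulr0.
have ugt0 : 0 < norm2 u by rewrite lt_def u0 norm2_ge0.
have norm2inv : `|(norm2 u)^-1| = (norm2 u)^-1.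
  by rewrite ger0_norm ?invr_ge0 ?norm2_ge0.
rewrite -ler_pdivrMr// mulrC -norm2inv -norm2Z scalemxAr.
apply: ub_le_sup; last first.
  by exists ((norm2 u)^-1 *: u) => //=; rewrite norm2Z norm2inv mulVf.
exists (Num.sqrt (\sum_i norm2 (row i A)^T ^+ 2)) => _ [w /= w1 <-].
apply: le_trans (norm2_mulmx_bounded _ _) _.
by rewrite ler_piMr ?sqrtr_ge0.
Qed.

End euclidean.

(** * First-order inequalities for smooth convex functions *)

Section first_order.
Context (R : realType).

(** Turns a quadratic remainder estimate into a derivative, so that [psi] can be differentiated
    across its kink without splitting cases. *)
Lemma is_derive_quad (V : normedModType R) (f : V -> R) (x v : V) (D C : R) :
  (forall t, `|f (x + t *: v) - f x - t * D| <= C * t ^+ 2) ->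
  is_derive x v f D.
Proof.
move=> fC.
have C0 : 0 <= C by have := fC 1; rewrite expr1n mulr1; apply: le_trans.
have cvgD : (fun h => h^-1 *: ((f \o shift x) (h *: v) - f x)) @ 0^' --> D.
  apply/cvgrPdist_le => e e0; near=> h.
  have h0 : h != 0 by near: h; exact: nbhs_dnbhs_neq.
  have -> : D - h^-1 *: ((f \o shift x) (h *: v) - f x) =
      - (h^-1 * (f (x + h *: v) - f x - h * D)).
    by rewrite /= addrC [h *: v + x]addrC /GRing.scale /=; field.
  rewrite normrN normrM normfV mulrC ler_pdivrMr ?normr_gt0//.
  apply: le_trans (fC _) _.
  rewrite -real_normK ?num_real// expr2 mulrA ler_pM2r ?normr_gt0//.
  (* [C + 1] keeps the divisor positive when [C = 0]. *)
  have hC : `|h| <= e / (C + 1).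
    near: h; apply/nbhs_dnbhs => /=.
    have := @cvgr0_norm_le _ _ _ (nbhs (0 : R)) _ id cvg_id (e / (C + 1)).
    by apply; rewrite divr_gt0// ltr_wpDl.
  rewrite (@le_trans _ _ ((C + 1) * `|h|))//.
    by rewrite ler_wpM2r// lerDl.
  by rewrite -ler_pdivlMl ?ltr_wpDl// mulrC.
split; first by apply/cvg_ex; exists D.
exact: cvg_lim cvgD.
Unshelve. all: by end_near. Qed.

Context (n : nat).
Implicit Types (phi : 'cV[R]_n -> R) (x u v : 'cV[R]_n).

Lemma derive_grad phi x v :
  differentiable phi x -> 'D_v phi x = dotp (grad phi x) v.
Proof.
move=> dphi; rewrite deriveE// {1}[v]matrix_sum_delta linear_sum /=.
apply: eq_bigr => i _; rewrite big_ord1 linearZ /= !mxE deriveE//.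
by rewrite mulrC.
Qed.

Lemma is_derive_line phi x v (t : R) : differentiable phi (x + t *: v) ->
  is_derive t 1 (fun s : R => phi (x + s *: v))
    (dotp (grad phi (x + t *: v)) v).
Proof.
move=> dphi; rewrite -derive_grad//.
have dv : derivable phi (x + t *: v) v by exact: diff_derivable.
pose psi (s : R) := phi (x + s *: v).
have E : (fun h : R => h^-1 *: ((phi \o shift (x + t *: v)) (h *: v) -
      phi (x + t *: v))) =
    (fun h : R => h^-1 *: ((psi \o shift t) (h *: 1) - psi t)).
  apply/funext => h.
  by rewrite /psi /= scalerDl [h *: 1]mulr1 addrCA.
by split; [rewrite /derivable -E | rewrite /derive E].
Qed.

Lemma convex_functionE phi :
  convex_function (setT : set (convex_lmodType 'cV[R]_n)) phi ->
  forall x u t, 0 <= t <= 1 ->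
    phi (t *: x + (1 - t) *: u) <= t * phi x + (1 - t) * phi u.
Proof.
move=> cphi x u t /andP[t0 t1].
by have := cphi (Itv01 t0 t1) x u (in_setT _) (in_setT _).
Qed.

(** By convexity each difference quotient with step in [(0, 1]] is at most [phi u - phi x]; the
    right limit inherits the bound. *)
Lemma convex_ge_tangent phi x u :
  convex_function (setT : set (convex_lmodType 'cV[R]_n)) phi ->
  differentiable phi x ->
  phi x + dotp (grad phi x) (u - x) <= phi u.
Proof.
move=> cphi dphi; rewrite -lerBrDl -derive_grad// /derive.
have dv : derivable phi x (u - x) by exact: diff_derivable.
rewrite cvg_at_rightE//; apply: limr_le.
  apply/cvg_ex; exists ('D_(u - x) phi x) => A /dv/nbhs_ballP[e /= e0 eA].
  by apply/nbhs_ballP; exists e => //= h eh h0; apply: eA => //; rewrite gt_eqF.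
near=> h.
have h0 : 0 < h by near: h; exact: nbhs_right_gt.
have h1 : h <= 1 by near: h; exact: nbhs_right_le.
rewrite [_ *: _]mulrC ler_pdivrMr//=.
rewrite -[h *: _ + x](_ : h *: u + (1 - h) *: x = _).
  have : 0 <= h <= 1 by rewrite ltW.
  by move=> /(convex_functionE cphi u x); lra.
by rewrite scalerBr scalerBl scale1r -addrA [- _ + x]addrC.
Unshelve. all: by end_near. Qed.

Lemma descent_lemma phi (D : set 'cV[R]_n) (L : R) x u :
  grad_lipschitz_on D L phi -> (forall w, differentiable phi w) ->
  (forall t, 0 <= t <= 1 -> D (x + t *: (u - x))) ->
  phi u <= phi x + dotp (grad phi x) (u - x) + L / 2 * norm2 (u - x) ^+ 2.
Proof.
move=> lip dphi Dxu; set v : 'cV[R]_n := u - x.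
(* The mean value theorem replaces integration along the segment: the Lipschitz bound makes the
   derivative of [G] nonpositive on [[0, 1]], so [G 1 <= G 0]. *)
pose G (s : R) : R := phi (x + s *: v) - (s * dotp (grad phi x) v +
  s ^+ 2 * (L / 2 * norm2 v ^+ 2)).
have dG (s : R) : is_derive s 1 G (dotp (grad phi (x + s *: v)) v
    - (dotp (grad phi x) v + s * (L * norm2 v ^+ 2))).
  have := is_derive_line (dphi (x + s *: v)) => ?.
  rewrite /G; apply: is_derive_eq.
  by rewrite /GRing.scale/=; field.
have cG : {within `[0, 1], continuous G}.
  have dvG (s : R) : derivable G s 1 by have [] := dG s.
  by apply: derivable_within_continuous => r _; exact: dvG.
have [c] := MVT ltr01 (fun s _ => dG s) cG.
rewrite in_itv/= => /andP[/ltW c0 /ltW c1].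
rewrite subr0 mulr1.
rewrite /G scale0r scale1r addr0 [x + v]addrC subrK.
have : dotp (grad phi (x + c *: v) - grad phi x) v <= c * (L * norm2 v ^+ 2).
  apply: le_trans (dotp_le _ _) _.
  have Dx : D x.
    by have := Dxu 0; rewrite scale0r addr0; apply; rewrite lexx ler01.
  have Dc : D (x + c *: v) by apply: Dxu; rewrite c0.
  have := lip _ _ Dc Dx; rewrite [x + _]addrC addrK norm2Z ger0_norm//.
  move=> /(ler_wpM2r (norm2_ge0 v)) /le_trans; apply; rewrite expr2; lra.
rewrite dotpDl dotpNl; lra.
Qed.

End first_order.

(** * The penalty psi and proximal steps *)

Section penalty.
Context (R : realType).
Implicit Types (a b beta u v : R).

Lemma pospart_ge0 a : 0 <= pospart a.
Proof. by rewrite /pospart le_max lexx. Qed.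

(** The squared positive part is convex and its derivative [2 * pospart a] is 2-Lipschitz: the two
    sides are its tangent and descent inequalities. *)
Lemma pospart_sqr_bounds a b :
  0 <= pospart b ^+ 2 - pospart a ^+ 2 - 2 * pospart a * (b - a)
    <= (b - a) ^+ 2.
Proof.
have ba0 := sqr_ge0 (b - a); rewrite /pospart.
by case: (lerP 0 a) => a0; case: (lerP 0 b) => b0; apply/andP; split; nra.
Qed.

(** Completing the square merges the two branches of [psi]. *)
Lemma psiE beta u v : 0 < beta ->
  psi beta u v = (pospart (beta * u + v) ^+ 2 - v ^+ 2) / (2 * beta).
Proof.
move=> b0; have bN0 : beta != 0 by rewrite gt_eqF.
by rewrite /psi /pospart; case: (lerP 0 (beta * u + v)) => ?; field.
Qed.

Lemma psi_bounds beta u v w : 0 < beta ->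
  0 <= psi beta w v - psi beta u v - pospart (beta * u + v) * (w - u)
    <= beta / 2 * (w - u) ^+ 2.
Proof.
move=> b0; have bN0 : beta != 0 by rewrite gt_eqF.
have := pospart_sqr_bounds (beta * u + v) (beta * w + v).
have -> : psi beta w v - psi beta u v - pospart (beta * u + v) * (w - u) =
  (pospart (beta * w + v) ^+ 2 - pospart (beta * u + v) ^+ 2 -
   2 * pospart (beta * u + v) * ((beta * w + v) - (beta * u + v))) / (2 * beta).
  by rewrite !psiE//; field.
have -> : beta / 2 * (w - u) ^+ 2 =
    ((beta * w + v) - (beta * u + v)) ^+ 2 / (2 * beta) by field.
have b20 : 0 < (2 * beta)^-1 by rewrite invr_gt0 mulr_gt0.
by move=> /andP[? ?]; rewrite pmulr_lge0// ler_pM2r//; apply/andP.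
Qed.

Lemma psi_le0 beta u v : 0 < beta -> u <= 0 -> 0 <= v -> psi beta u v <= 0.
Proof.
move=> b0 u0 v0; rewrite /psi.
case: (lerP 0 (beta * u + v)) => uv; first by nra.
by rewrite oppr_le0 divr_ge0 ?sqr_ge0// mulr_ge0// ltW.
Qed.

(** Both branches are one quadratic, evaluated at the increment [s] that the update of [z] uses;
    this is what links the penalty to the dual energy. *)
Lemma psi_max beta u v (s := Num.max (- (v / beta)) u) : 0 < beta ->
  psi beta u v = s * v + beta / 2 * s ^+ 2.
Proof.
move=> b0; have bN0 : beta != 0 by rewrite gt_eqF.
have E : (0 <= beta * u + v) = (- (v / beta) <= u).
  by rewrite -lerBlDr sub0r -mulNr ler_pdivrMr// [u * _]mulrC.
by rewrite /s /psi E; case: (lerP (- (v / beta)) u) => ?; field.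
Qed.

End penalty.

Section prox.
Context (R : realType) (n : nat) (h : 'cV[R]_n -> \bar R).
Context (hproper : proper_fun h) (hconvex : econvex_fun h).
Implicit Types (x u c : 'cV[R]_n).

Lemma edom_fineK x : edom h x -> (fine (h x))%:E = h x.
Proof.
move=> hx; apply: fineK; rewrite fin_numE -ltNye -ltey hx andbT.
by have [+ _] := hproper; apply.
Qed.

Lemma edom_convex x u t : edom h x -> edom h u -> 0 <= t <= 1 ->
  edom h (t *: x + (1 - t) *: u) /\
  fine (h (t *: x + (1 - t) *: u)) <= t * fine (h x) + (1 - t) * fine (h u).
Proof.
move=> hx hu t01; have hle := hconvex x u t01.
rewrite -(edom_fineK hx) -(edom_fineK hu) -!EFinM -EFinD in hle.
have hd : edom h (t *: x + (1 - t) *: u) by apply: le_lt_trans hle (ltry _).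
by split => //; rewrite -lee_fin edom_fineK.
Qed.

Lemma edom_segment x u t : edom h x -> edom h u -> 0 <= t <= 1 ->
  edom h (x + t *: (u - x)).
Proof.
move=> hx hu t01; have [+ _] := edom_convex hu hx t01.
by rewrite scalerBr scalerBl scale1r addrCA.
Qed.

Lemma ge0_of_perturb (a b : R) :
  (forall t, 0 < t <= 1 -> 0 <= a + t * b) -> 0 <= a.
Proof.
move=> ab; rewrite leNgt; apply/negP => a0.
have d0 : 0 < 2 * (`|b| - a).
  by rewrite mulr_gt0// subr_gt0 (lt_le_trans a0).
(* For this [t], [t * |b| = - a / 2 + t * a], so [a + t * b] is below [a / 2 < 0]. *)
pose t := - a / (2 * (`|b| - a)).
have tE : t * (`|b| - a) = - a / 2.
  by rewrite /t; field; move: d0; rewrite pmulr_rgt0// => /gt_eqF ->.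
have t0 : 0 < t by rewrite divr_gt0// oppr_gt0.
have t1 : t <= 1.
  by rewrite ler_pdivrMr// mul1r; have := normr_ge0 b; lra.
have := ab t; rewrite t0 t1 => /(_ isT).
have : t * b <= t * `|b| by rewrite ler_pM2l// ler_norm.
have : 0 < t * - a by rewrite mulr_gt0// oppr_gt0.
lra.
Qed.

Lemma argmin_prox_edom c x (eta : R) xp :
  is_argmin
    (fun u => h u + (dotp c u + eta / 2 * norm2 (u - x) ^+ 2)%:E)%E xp ->
  edom h xp.
Proof.
have [hNy [w hw]] := hproper; move=> /(_ w).
rewrite -(edom_fineK hw) -EFinD => hle.
rewrite /edom /= ltey; apply: contraTneq hle => ->.
by rewrite addye// leye_eq.
Qed.

(* The quadratic term makes the prox objective eta-strongly convex, which is  *)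
(* where the gain [eta / 2 * norm2 (xp - u) ^+ 2] comes from.                 *)
Lemma argmin_prox_le c x (eta : R) xp u :
  is_argmin
    (fun u => h u + (dotp c u + eta / 2 * norm2 (u - x) ^+ 2)%:E)%E xp ->
  edom h u ->
  fine (h xp) + dotp c (xp - u)
    + eta / 2 * (norm2 (xp - x) ^+ 2 + norm2 (xp - u) ^+ 2 - norm2 (x - u) ^+ 2)
    <= fine (h u).
Proof.
move=> xpmin hu; have hxp := argmin_prox_edom xpmin.
(* The minimizer is compared with [t *: u + (1 - t) *: xp]. After division by [t] the only term
   still depending on [t] is this multiple of it, which vanishes in the limit. *)
rewrite -subr_ge0; apply: (@ge0_of_perturb _ (eta / 2 * norm2 (u - xp) ^+ 2)).
move=> t /andP[t0 t1]; have t01 : 0 <= t <= 1 by rewrite ltW.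
have [hw wle] := edom_convex hu hxp t01.
have le1 := xpmin (t *: u + (1 - t) *: xp).
rewrite -(edom_fineK hxp) -(edom_fineK hw) -!EFinD lee_fin in le1.
move: le1; have -> : t *: u + (1 - t) *: xp - x = (xp - x) + t *: (u - xp).
  by apply/colP => i; rewrite !mxE; ring.
have -> : norm2 (xp - u) ^+ 2 = norm2 (u - xp) ^+ 2 by rewrite -norm2N opprB.
have -> : x - u = - ((xp - x) + (u - xp)).
  by apply/colP => i; rewrite !mxE; ring.
have -> : dotp c (t *: u + (1 - t) *: xp) = dotp c xp + t * dotp c (u - xp).
  by rewrite -dotpZr -dotpDr; congr dotp; apply/colP => i; rewrite !mxE; ring.
have -> : dotp c (xp - u) = - dotp c (u - xp) by rewrite -dotpNr opprB.
rewrite norm2N; move: (xp - x) (u - xp) => a d.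
rewrite !norm2_sqrD norm2Z (ger0_norm (ltW t0)) dotpZr exprMn => le1.
by rewrite -(pmulr_rge0 _ t0); move: wle le1; lra.
Qed.

End prox.

(** * The augmented Lagrangian *)

Section chain.
Context (R : realType).

Lemma is_derive_comp_scalar (V : normedModType R) (g : R -> R) (f : V -> R)
    (x v : V) (dg : R) :
  is_derive (f x) 1 g dg -> differentiable f x ->
  is_derive x v (g \o f) (dg * 'D_v f x).
Proof.
move=> [dgx <-] df; set dg' := 'D_1 g (f x).
 have dgf : differentiable g (f x) by apply/derivable1_diffP.
have dc : differentiable (g \o f) x by exact: differentiable_comp.
have dcv : derivable (g \o f) x v by exact: diff_derivable.
have -> : dg' * 'D_v f x = 'D_v (g \o f) x.
  rewrite (deriveE _ dc) (diff_comp df dgf) (deriveE _ df) /=.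
  rewrite /dg' (deriveE _ dgf) mulrC -[X in _ = 'd g _ X]mulr1.
  exact/esym/linearZ.
exact: derivableP.
Qed.

Lemma is_derive_psi (beta u v : R) : 0 < beta ->
  is_derive u 1 (fun s => psi beta s v) (pospart (beta * u + v)).
Proof.
move=> b0; apply: (@is_derive_quad _ _ _ _ _ _ (beta / 2)) => t.
have := psi_bounds u v (u + t) b0.
rewrite [t *: 1]mulr1 [u + t - u]addrC addKr [t * _]mulrC => /andP[? ?].
by rewrite ger0_norm.
Qed.

End chain.

Section augmented_lagrangian.
Context (R : realType) (p q m : nat) (P : program R p q m).
Context (beta : R) (hbeta : 0 < beta).
Implicit Types (x u v : 'cV[R]_p) (y : 'cV[R]_q) (z : 'cV[R]_m).

Let A := pA P.
Let b := pb P.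
Let g := pg P.
Let f := pf P.
Let h := ph P.

(** Closed form of the gradient of [Fbeta] in [x], justified by [grad_FbetaE]. *)
Definition grad_Fbeta x y z : 'cV[R]_p :=
  grad g x + A^T *m (y + beta *: (A *m x - b))
  + \sum_j pospart (beta * f j x + z j 0) *: grad (f j) x.

Lemma dotp_grad_Fbeta x y z v : dotp (grad_Fbeta x y z) v =
  dotp (grad g x) v + (dotp y (A *m v) + beta * dotp (A *m x - b) (A *m v))
  + \sum_j pospart (beta * f j x + z j 0) * dotp (grad (f j) x) v.
Proof.
rewrite 2!dotpDl dotp_trmx dotpDl dotpZl dotp_suml; congr (_ + _).
by apply: eq_bigr => j _; rewrite dotpZl.
Qed.

Lemma residual_shift x u : A *m u - b = (A *m x - b) + A *m (u - x).
Proof.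
rewrite mulmxBr; move: (A *m u) (A *m x) => c d.
by apply/colP => i; rewrite !mxE; ring.
Qed.

(** An exact Taylor expansion, which serves the gradient, the descent inequality and the tangent
    inequality alike. *)
Lemma quadratic_term_expansion x u y :
  dotp y (A *m u - b) + beta / 2 * norm2 (A *m u - b) ^+ 2 =
  dotp y (A *m x - b) + beta / 2 * norm2 (A *m x - b) ^+ 2
  + (dotp y (A *m (u - x)) + beta * dotp (A *m x - b) (A *m (u - x)))
  + beta / 2 * norm2 (A *m (u - x)) ^+ 2.
Proof.
by rewrite (residual_shift x u) norm2_sqrD dotpDr; field.
Qed.

Lemma pg_differentiable x : differentiable g x.
Proof. by case: (pg_smooth P). Qed.

Lemma pf_differentiable j x : differentiable (f j) x.
Proof. by case: (pf_smooth P j). Qed.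

Lemma grad_FbetaE x y z :
  grad (fun w => Fbeta P beta w y z) x = grad_Fbeta x y z.
Proof.
apply/colP => i; rewrite mxE -(dotp_delta (grad_Fbeta _ _ _)).
set v := delta_mx i 0; rewrite dotp_grad_Fbeta.
pose Q (w : 'cV[R]_p) : R :=
  dotp y (A *m w - b) + beta / 2 * norm2 (A *m w - b) ^+ 2.
have dQ : is_derive x v Q
    (dotp y (A *m v) + beta * dotp (A *m x - b) (A *m v)).
  apply: (@is_derive_quad _ _ _ _ _ _ (beta / 2 * norm2 (A *m v) ^+ 2)) => t.
  rewrite /Q (quadratic_term_expansion x (x + t *: v) y).
  rewrite [x + t *: v - x]addrC addKr -scalemxAr !dotpZr norm2Z exprMn.
  rewrite real_normK ?num_real//.
  set Z := (X in `|X|); have -> : Z = beta / 2 * norm2 (A *m v) ^+ 2 * t ^+ 2.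
    by rewrite /Z; field.
  by rewrite ger0_norm// mulr_ge0 ?sqr_ge0// mulr_ge0 ?sqr_ge0// divr_ge0// ltW.
have dg : is_derive x v g (dotp (grad g x) v).
  rewrite -derive_grad; last exact: pg_differentiable.
  by apply: derivableP; apply: diff_derivable; exact: pg_differentiable.
have df j : is_derive x v (fun w => psi beta (f j w) (z j 0))
    (pospart (beta * f j x + z j 0) * dotp (grad (f j) x) v).
  rewrite -derive_grad; last exact: pf_differentiable.
  exact: (is_derive_comp_scalar v (is_derive_psi _ (z j 0) hbeta)
    (pf_differentiable j x)).
(* As a sum of functions whose derivatives are in the context, [Fbeta] is differentiated by instance
   resolution. *)
have -> : (fun w => Fbeta P beta w y z) =
    g + Q + \sum_(j < m) (fun w => psi beta (f j w) (z j 0)).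
  apply/funext => w; rewrite /Fbeta /Psi !fctE /Q fct_sumE.
  by rewrite [in RHS]addrA.
exact: derive_val.
Qed.

Context (Lg : R) (L B : 'I_m -> R) (hlip : lipschitz_bounded P Lg L B).

(** The terms of [LF] add up: [Lg] from [g], [beta * spectral_norm A ^+ 2] from the quadratic term,
    and for each [j] the curvature of [psi] times [B j ^+ 2] plus its slope times [L j]. *)
Lemma Fbeta_descent x u y z : edom h x -> edom h u ->
  Fbeta P beta u y z <= Fbeta P beta x y z + dotp (grad_Fbeta x y z) (u - x)
    + LF P Lg L B beta x z / 2 * norm2 (u - x) ^+ 2.
Proof.
have [Lg0 L0 lipg lipf gradB] := hlip.
move=> hx hu; set d := norm2 (u - x).
have seg (t : R) : 0 <= t <= 1 -> edom h (x + t *: (u - x)).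
  by move=> t01; apply: edom_segment t01 => //;
    [exact: ph_proper|exact: ph_convex].
have hg := descent_lemma lipg pg_differentiable seg.
have hf j : psi beta (f j u) (z j 0) <= psi beta (f j x) (z j 0) +
    pospart (beta * f j x + z j 0) * dotp (grad (f j) x) (u - x) +
    (beta * B j ^+ 2 + L j * pospart (beta * f j x + z j 0)) / 2 * d ^+ 2.
  have fdesc := descent_lemma (lipf j) (pf_differentiable j) seg.
  (* The tangents at both endpoints bound [f j u - f j x] from either side, using gradients only at
     points of the domain of [h]. *)
  have tan_x := convex_ge_tangent u (let: And3 c _ _ := pf_smooth P j in c)
    (pf_differentiable j x).
  have tan_u := convex_ge_tangent x (let: And3 c _ _ := pf_smooth P j in c)
    (pf_differentiable j u).
  have Bj w : edom h w -> `|dotp (grad (f j) w) (u - x)| <= B j * d.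
    move=> hw; apply: le_trans (cauchy_schwarz _ _) _.
    by rewrite ler_wpM2r ?norm2_ge0// gradB.
  have {}tan_u : f j u - f j x <= B j * d.
    have := ler_norm (dotp (grad (f j) u) (u - x)); have := Bj _ hu.
    by move: tan_u; rewrite -(opprB u x) dotpNr -/f; lra.
  have {}tan_x : - (B j * d) <= f j u - f j x.
    have := Bj _ hx; rewrite ler_norml => /andP[+ _].
    by move: tan_x; rewrite -/f; lra.
  have sq : (f j u - f j x) ^+ 2 <= B j ^+ 2 * d ^+ 2.
    rewrite -exprMn -[leLHS]real_normK ?num_real//.
    by rewrite ler_sqr ?nnegrE ?ler_norml ?tan_x//; lra.
  have /andP[_] := psi_bounds (f j x) (z j 0) (f j u) hbeta.
  have : pospart (beta * f j x + z j 0) * (f j u - f j x) <=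
    pospart (beta * f j x + z j 0) *
    (dotp (grad (f j) x) (u - x) + L j / 2 * d ^+ 2).
    by rewrite ler_wpM2l ?pospart_ge0//; move: fdesc; rewrite -/f -/d; lra.
  by have := ler_wpM2l (ltW hbeta) sq; lra.
have hA : norm2 (A *m (u - x)) ^+ 2 <= spectral_norm A ^+ 2 * d ^+ 2.
  have := norm2_mulmx A (u - x); rewrite -exprMn => Ale.
  by rewrite ler_sqr ?nnegrE ?norm2_ge0// (le_trans (norm2_ge0 (A *m (u - x)))).
have hPsi : Psi P beta u z <= Psi P beta x z +
    \sum_j pospart (beta * f j x + z j 0) * dotp (grad (f j) x) (u - x) +
    (\sum_j (beta * B j ^+ 2 + L j * pospart (beta * f j x + z j 0)))
      / 2 * d ^+ 2.
  rewrite /Psi !mulr_suml -!big_split /=; apply: ler_sum => j _.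
  exact: hf.
have := quadratic_term_expansion x u y.
rewrite /Fbeta /LF dotp_grad_Fbeta -/A -/b -/f -/g -/d.
have := ler_wpM2l (ltW hbeta) hA.
move: hPsi hg; rewrite -/f -/g -/d.
set S := \sum_(j < m) _ * dotp _ _; set T := \sum_(j < m) (_ + _ * _).
lra.
Qed.

(** Convexity survives composition with [psi] because its slope, a positive part, is nonnegative. *)
Lemma Fbeta_ge_tangent x u y z :
  Fbeta P beta x y z + dotp (grad_Fbeta x y z) (u - x) <= Fbeta P beta u y z.
Proof.
have hg := convex_ge_tangent u (let: And3 c _ _ := pg_smooth P in c)
  (pg_differentiable x).
have hPsi : Psi P beta x z +
    \sum_j pospart (beta * f j x + z j 0) * dotp (grad (f j) x) (u - x) <=
    Psi P beta u z.
  rewrite /Psi -big_split; apply: ler_sum => j _ /=.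
  have := convex_ge_tangent u (let: And3 c _ _ := pf_smooth P j in c)
    (pf_differentiable j x).
  have /andP[+ _] := psi_bounds (f j x) (z j 0) (f j u) hbeta.
  rewrite -lerBrDl => psi0 /(ler_wpM2l (pospart_ge0 (beta * f j x + z j 0))).
  by move: psi0; rewrite -/f; lra.
have := quadratic_term_expansion x u y.
have : 0 <= beta / 2 * norm2 (A *m (u - x)) ^+ 2.
  by rewrite mulr_ge0 ?sqr_ge0// divr_ge0// ltW.
rewrite /Fbeta dotp_grad_Fbeta -/A -/b -/f -/g.
move: hPsi hg; rewrite -/f -/g.
set S := \sum_(j < m) _ * dotp _ _.
lra.
Qed.

End augmented_lagrangian.

(** * Weighted averages and telescoping *)

Section jensen.
Context (R : realType) (n : nat) (D : set 'cV[R]_n) (F : 'cV[R]_n -> R).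
Context (convF : forall x u t, D x -> D u -> 0 <= t <= 1 ->
  D (t *: x + (1 - t) *: u) /\
  F (t *: x + (1 - t) *: u) <= t * F x + (1 - t) * F u).
Context (w : nat -> R) (x : nat -> 'cV[R]_n).
Context (w0 : forall t, 0 < w t) (Dx : forall t, D (x t)).

Lemma weights_gt0 k : 0 < \sum_(t < k.+1) w t.
Proof.
elim: k => [|k IH]; first by rewrite big_ord1.
by rewrite big_ord_recr addr_gt0.
Qed.

(** Induction on the number of points, merging the new point with the average so far. Membership in
    [D] is carried along because the two-point inequality needs it. *)
Lemma jensen k (xk := (\sum_(t < k.+1) w t)^-1 *: \sum_(t < k.+1) w t *: x t) :
  D xk /\ F xk <= (\sum_(t < k.+1) w t)^-1 * \sum_(t < k.+1) w t * F (x t).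
Proof.
rewrite /xk => {xk}; elim: k => [|k [Dk Fk]].
  rewrite !big_ord1 scalerA mulrA mulVf ?gt_eqF// scale1r mul1r.
  by split => //; exact: Dx.
rewrite 3!(big_ord_recr k.+1) /=.
have S0 := weights_gt0 k; set S := \sum_(t < k.+1) w t in S0 Dk Fk *.
set xS := \sum_(t < k.+1) w t *: x t in Dk Fk *.
set FS := \sum_(t < k.+1) w t * F (x t) in Fk *.
have wk := w0 k.+1; set v := w k.+1 in wk *.
have Sv : 0 < S + v by rewrite addr_gt0.
have SN : S != 0 by rewrite gt_eqF.
have SvN : S + v != 0 by rewrite gt_eqF.
pose s := S / (S + v).
have s01 : 0 <= s <= 1.
  by rewrite divr_ge0 ?(ltW S0) ?(ltW Sv)//= ler_pdivrMr// mul1r lerDl ltW.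
have s1 : 1 - s = v / (S + v) by rewrite /s; field.
have [Ds Fs] := convF Dk (Dx k.+1) s01.
have E : (S + v)^-1 *: (xS + v *: x k.+1) =
    s *: (S^-1 *: xS) + (1 - s) *: x k.+1.
  rewrite s1 scalerDr !scalerA; congr (_ *: _ + _ *: _); last exact: mulrC.
  by rewrite /s; field; apply/andP.
rewrite E; split => //; apply: le_trans Fs _.
have /andP[sge0 _] := s01.
apply: le_trans (lerD (ler_wpM2l sge0 Fk) (lexx _)) _.
rewrite le_eqVlt; apply/orP; left; apply/eqP.
by rewrite s1 /s; field; apply/andP.
Qed.

End jensen.

Section telescope.
Context (R : realType) (eta a X E : nat -> R).

(* Dividing by the nondecreasing weights before summing makes both the        *)
(* distance and the multiplier energies telescope.                            *)
Lemma weighted_telescope :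
  (forall k, 0 < eta k) -> (forall k, eta k <= eta k.+1) ->
  (forall k, 0 <= E k) ->
  (forall k, a k + eta k / 2 * X k.+1 + E k.+1 <= eta k / 2 * X k + E k) ->
  forall k, \sum_(t < k.+1) (eta t)^-1 * a t + X k.+1 / 2 + E k.+1 / eta k
    <= X 0%N / 2 + E 0%N / eta 0%N.
Proof.
move=> eta0 etaS E0 step.
have stepV k : (eta k)^-1 * a k + X k.+1 / 2 + E k.+1 / eta k <=
    X k / 2 + E k / eta k.
  have etaN : eta k != 0 by rewrite gt_eqF.
  have eV : 0 < (eta k)^-1 by rewrite invr_gt0.
  have := step k; rewrite -(ler_pM2l eV) => /le_trans le1.
  have -> : (eta k)^-1 * a k + X k.+1 / 2 + E k.+1 / eta k =
    (eta k)^-1 * (a k + eta k / 2 * X k.+1 + E k.+1) by field.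
  by apply: le1; rewrite le_eqVlt; apply/orP; left; apply/eqP; field.
elim=> [|k IH]; first by rewrite big_ord1; exact: stepV.
rewrite big_ord_recr /=; have := stepV k.+1.
have : E k.+1 / eta k.+1 <= E k.+1 / eta k.
  by rewrite ler_wpM2l// lef_pV2 ?posrE.
lra.
Qed.

End telescope.

(** * Convergence of LALM *)

Section LALM.
Context (R : realType) (p q m : nat) (P : program R p q m).
Context (Lg : R) (L B : 'I_m -> R) (beta rhoy rhoz delta : R).
Context (x : nat -> 'cV[R]_p) (y : nat -> 'cV[R]_q) (z : nat -> 'cV[R]_m).
Context (eta : nat -> R).
Context (hlip : lipschitz_bounded P Lg L B).
Context (hbeta : 0 < beta) (hdelta : 0 <= delta).
Context (hrhoy : 0 < rhoy <= beta) (hrhoz : 0 < rhoz <= beta).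
Context (hLALM : is_LALM P Lg L B beta rhoy rhoz delta x y z eta).
Context (hx0 : edom (ph P) (x 0%N)) (hz0 : z 0%N = 0) (heta0 : 0 < eta 0%N).

Implicit Types (u : 'cV[R]_p) (v : 'cV[R]_q) (w : 'cV[R]_m).

Let A := pA P.
Let b := pb P.
Let g := pg P.
Let f := pf P.
Let hr u := fine (ph P u).

(** The ordinary Lagrangian, without augmentation. Taking [fine] of [h] is faithful on the domain of
    [h], where the iterates and their averages lie. *)
Definition lagrangian u v w : R :=
  g u + hr u + dotp v (A *m u - b) + \sum_j w j 0 * f j u.

Definition energy v w k : R :=
  norm2 (y k - v) ^+ 2 / (2 * rhoy) + norm2 (z k - w) ^+ 2 / (2 * rhoz).

Let rhoy0 : 0 < rhoy. Proof. by case/andP: hrhoy. Qed.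
Let rhoz0 : 0 < rhoz. Proof. by case/andP: hrhoz. Qed.

Lemma energy_ge0 v w k : 0 <= energy v w k.
Proof. by rewrite addr_ge0// divr_ge0 ?sqr_ge0// mulr_ge0// ltW. Qed.

Lemma eta_mono k : eta k <= eta k.+1.
Proof. by rewrite (LALM_eta hLALM k.+1) le_max lexx. Qed.

Lemma eta_gt0 k : 0 < eta k.
Proof. by elim: k => // k IH; exact: lt_le_trans (eta_mono k). Qed.

Lemma LF_le_eta k : LF P Lg L B beta (x k) (z k) <= eta k.
Proof.
rewrite (LALM_eta hLALM k) le_max; apply/orP; right; by rewrite lerDl.
Qed.

Lemma iterate_edom k : edom (ph P) (x k).
Proof.
by case: k => // k; exact: (argmin_prox_edom (ph_proper P) (LALM_x hLALM k)).
Qed.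

(** The increment is at least [- rhoz * z / beta], and [rhoz <= beta], so a step never removes more
    than the current value. *)
Lemma multiplier_ge0 k j : 0 <= z k j 0.
Proof.
elim: k => [|k IH]; first by rewrite hz0 mxE.
rewrite (LALM_z hLALM).
have /(ler_wpM2l (ltW rhoz0)) : - (z k j 0 / beta) <=
  Num.max (- (z k j 0 / beta)) (pf P j (x k.+1)) by rewrite le_max lexx.
have : rhoz * (z k j 0 / beta) <= z k j 0.
  rewrite mulrCA ler_piMr// ler_pdivrMr// mul1r.
  by case/andP: hrhoz.
lra.
Qed.

Lemma primal_step k u : edom (ph P) u ->
  hr (x k.+1) + Fbeta P beta (x k.+1) (y k) (z k)
    + eta k / 2 * norm2 (x k.+1 - u) ^+ 2
  <= hr u + Fbeta P beta u (y k) (z k) + eta k / 2 * norm2 (x k - u) ^+ 2.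
Proof.
move=> hu.
have := argmin_prox_le (ph_proper P) (ph_convex P) (LALM_x hLALM k) hu.
rewrite grad_FbetaE//.
have := Fbeta_descent hbeta hlip (y k) (z k) (iterate_edom k)
  (iterate_edom k.+1).
have := Fbeta_ge_tangent P hbeta (x k) u (y k) (z k).
set G := grad_Fbeta _ _ _ _ _.
have -> : dotp G (x k.+1 - u) = dotp G (x k.+1 - x k) - dotp G (u - x k).
  by rewrite -dotpNr -dotpDr opprB subrKA.
have := ler_wpM2r (sqr_ge0 (norm2 (x k.+1 - x k))) (LF_le_eta k).
rewrite -/(hr _) -/(hr _); lra.
Qed.

Lemma Fbeta_feasible u v w : A *m u = b -> (forall j, f j u <= 0) ->
  (forall j, 0 <= w j 0) -> Fbeta P beta u v w <= g u.
Proof.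
move=> Au fu w0; rewrite /Fbeta -/A -/b Au subrr norm2_0 dotpC dotp0l.
rewrite expr0n mulr0 !addr0 gerDl.
by apply: sumr_le0 => j _; exact: psi_le0.
Qed.

(** Expanding the square after the update produces [dotp (y k - v) r + rhoy / 2 * norm2 r ^+ 2], and
    [rhoy <= beta]. *)
Lemma equality_multiplier_step k v (r := A *m x k.+1 - b) :
  dotp v r + norm2 (y k.+1 - v) ^+ 2 / (2 * rhoy)
    - norm2 (y k - v) ^+ 2 / (2 * rhoy)
  <= dotp (y k) r + beta / 2 * norm2 r ^+ 2.
Proof.
rewrite (LALM_y hLALM) -/A -/b -/r [y k + _ - v]addrAC.
rewrite (norm2_sqrD (y k - v)) norm2Z dotpZr exprMn.
rewrite (ger0_norm (ltW rhoy0)) dotpDl dotpNl.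
have rN : rhoy != 0 by rewrite gt_eqF.
set N := norm2 (y k - v) ^+ 2.
have -> : (N + 2 * (rhoy * (dotp (y k) r - dotp v r)) +
    rhoy ^+ 2 * norm2 r ^+ 2) / (2 * rhoy) =
  N / (2 * rhoy) + (dotp (y k) r - dotp v r) + rhoy * norm2 r ^+ 2 / 2.
  by field.
have : rhoy * norm2 r ^+ 2 <= beta * norm2 r ^+ 2.
  by rewrite ler_wpM2r ?sqr_ge0//; case/andP: hrhoy.
lra.
Qed.

(** The same expansion in each coordinate, with the increment [s] of [psi_max] as residual;
    [w j 0 >= 0] allows [f j] to be replaced by the larger [s]. *)
Lemma inequality_multiplier_step k w : (forall j, 0 <= w j 0) ->
  \sum_j w j 0 * f j (x k.+1) + norm2 (z k.+1 - w) ^+ 2 / (2 * rhoz)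
    - norm2 (z k - w) ^+ 2 / (2 * rhoz)
  <= Psi P beta (x k.+1) (z k).
Proof.
move=> w0; have rN : rhoz != 0 by rewrite gt_eqF.
rewrite !norm2_sqr /dotp !mulr_suml -sumrN -!big_split /Psi /=.
apply: ler_sum => j _; rewrite (psi_max _ _ hbeta) !mxE (LALM_z hLALM).
set s := Num.max _ _.
have fs : w j 0 * f j (x k.+1) <= w j 0 * s.
  by rewrite ler_wpM2l// /s le_max lexx orbT.
have : rhoz * s ^+ 2 <= beta * s ^+ 2.
  by rewrite ler_wpM2r ?sqr_ge0//; case/andP: hrhoz.
set c := z k j 0; set d := w j 0 in fs *.
have -> : (c + rhoz * s - d) * (c + rhoz * s - d) / (2 * rhoz) =
  (c - d) * (c - d) / (2 * rhoz) + (c - d) * s + rhoz * s ^+ 2 / 2 by field.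
lra.
Qed.

Lemma LALM_step k u v w :
  edom (ph P) u -> A *m u = b -> (forall j, f j u <= 0) ->
  (forall j, 0 <= w j 0) ->
  lagrangian (x k.+1) v w - (g u + hr u)
    + eta k / 2 * norm2 (x k.+1 - u) ^+ 2 + energy v w k.+1
  <= eta k / 2 * norm2 (x k - u) ^+ 2 + energy v w k.
Proof.
move=> hu Au fu w0.
have := primal_step k hu; have := Fbeta_feasible (y k) Au fu (multiplier_ge0 k).
have := equality_multiplier_step k v; have := inequality_multiplier_step k w0.
rewrite /lagrangian /energy [in Fbeta _ _ (x k.+1) _ _]/Fbeta -/A -/b -/g.
lra.
Qed.

Lemma LALM_sum k u v w :
  edom (ph P) u -> A *m u = b -> (forall j, f j u <= 0) ->
  (forall j, 0 <= w j 0) ->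
  \sum_(t < k.+1) (eta t)^-1 * (lagrangian (x t.+1) v w - (g u + hr u))
    + norm2 (x k.+1 - u) ^+ 2 / 2 + energy v w k.+1 / eta k
  <= norm2 (x 0%N - u) ^+ 2 / 2 + energy v w 0 / eta 0%N.
Proof.
move=> hu Au fu w0.
apply: (@weighted_telescope _ eta
  (fun t => lagrangian (x t.+1) v w - (g u + hr u))
  (fun t => norm2 (x t - u) ^+ 2) (energy v w)).
- exact: eta_gt0.
- exact: eta_mono.
- exact: energy_ge0.
- by move=> t; exact: LALM_step.
Qed.

(** * Ergodic averages of the Lagrangian gap *)

Lemma lagrangian_convex v w : (forall j, 0 <= w j 0) ->
  forall u u' t, edom (ph P) u -> edom (ph P) u' -> 0 <= t <= 1 ->
  edom (ph P) (t *: u + (1 - t) *: u') /\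
  lagrangian (t *: u + (1 - t) *: u') v w <=
    t * lagrangian u v w + (1 - t) * lagrangian u' v w.
Proof.
move=> w0 u u' t hu hu' t01.
have [hd hle] := edom_convex (ph_proper P) (ph_convex P) hu hu' t01.
split => //; rewrite /lagrangian.
have [cg _ _] := pg_smooth P; have gle := convex_functionE cg u u' t01.
have fle : \sum_j w j 0 * f j (t *: u + (1 - t) *: u') <=
    t * (\sum_j w j 0 * f j u) + (1 - t) * \sum_j w j 0 * f j u'.
  rewrite !mulr_sumr -big_split; apply: ler_sum => j _ /=.
  have [cf _ _] := pf_smooth P j.
  have := ler_wpM2l (w0 j) (convex_functionE cf u u' t01).
  by rewrite -/f; lra.
have -> : A *m (t *: u + (1 - t) *: u') - b =
    t *: (A *m u - b) + (1 - t) *: (A *m u' - b).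
  rewrite mulmxDr -!scalemxAr; move: (A *m u) (A *m u') => c d.
  by apply/colP => i; rewrite !mxE; ring.
move: hle gle; rewrite dotpDr !dotpZr -/g -!/(hr _); lra.
Qed.

Lemma ergodic_edom k : edom (ph P) (ergodic eta x k).
Proof.
have w00 : forall j, 0 <= (0 : 'cV[R]_m) j 0 by move=> j; rewrite mxE.
have eV t : 0 < (eta t)^-1 by rewrite invr_gt0 eta_gt0.
by have [] := jensen (lagrangian_convex 0 w00) eV
  (fun t => iterate_edom t.+1) k.
Qed.

Lemma ergodic_lagrangian k u v w c :
  edom (ph P) u -> A *m u = b -> (forall j, f j u <= 0) ->
  (forall j, 0 <= w j 0) -> (forall t, eta t <= c) -> y 0%N = 0 ->
  lagrangian (ergodic eta x k) v w - (g u + hr u) <=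
  c / (eta 0%N * k.+1%:R) * (eta 0%N / 2 * norm2 (x 0%N - u) ^+ 2
    + norm2 v ^+ 2 / (2 * rhoy) + norm2 w ^+ 2 / (2 * rhoz)).
Proof.
move=> hu Au fu w0 etac hy0.
have eV t : 0 < (eta t)^-1 by rewrite invr_gt0 eta_gt0.
have [_] := jensen (lagrangian_convex v w0) eV
  (fun t => iterate_edom t.+1) k.
rewrite -/(ergodic eta x k).
have S0 := weights_gt0 eV k; set S := \sum_(t < k.+1) (eta t)^-1 in S0 *.
have := LALM_sum k v hu Au fu w0.
under eq_bigr do rewrite mulrBr.
rewrite sumrB -mulr_suml -/S; set T := \sum_(t < k.+1) _ => sumle ergle.
have X0 := sqr_ge0 (norm2 (x k.+1 - u)).
have E0 : 0 <= energy v w k.+1 / eta k.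
  by rewrite divr_ge0 ?energy_ge0 ?(ltW (eta_gt0 _)).
have c0 : 0 < c := lt_le_trans heta0 (etac 0%N).
have k0 : (0 : R) < k.+1%:R by rewrite ltr0n.
(* Each weight is at least [1 / c]; this is the source of the factor [c / k.+1]. *)
have Sge : k.+1%:R / c <= S.
  rewrite -[k.+1 in leLHS]card_ord -sumr_const mulr_suml; apply: ler_sum => t _.
  by rewrite mul1r lef_pV2 ?posrE ?eta_gt0.
have SV : S^-1 <= c / k.+1%:R.
  by rewrite -[c / _]invf_div lef_pV2// posrE divr_gt0.
set C := norm2 (x 0%N - u) ^+ 2 / 2 + energy v w 0 / eta 0%N in sumle.
have C0 : 0 <= C.
  by rewrite addr_ge0// divr_ge0 ?sqr_ge0 ?energy_ge0 ?(ltW heta0).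
have TC : S^-1 * T - (g u + hr u) <= S^-1 * C.
  have -> : S^-1 * T - (g u + hr u) = S^-1 * (T - S * (g u + hr u)).
    by field; rewrite gt_eqF.
  by rewrite ler_pM2l ?invr_gt0//; lra.
have eN : eta 0%N != 0 by rewrite gt_eqF.
have kN : k.+1%:R != 0 :> R by rewrite gt_eqF.
apply: (@le_trans _ _ (S^-1 * C)); first by lra.
apply: le_trans (ler_wpM2r C0 SV) _.
rewrite le_eqVlt; apply/orP; left; apply/eqP.
rewrite /C /energy hy0 hz0 !sub0r !norm2N.
set Ny := _ / (2 * rhoy); set Nz := _ / (2 * rhoz).
by field; apply/andP.
Qed.

(** * Distance to the KKT point and boundedness of [eta] *)

Context (xs : 'cV[R]_p) (ys : 'cV[R]_q) (zs : 'cV[R]_m).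
Context (hKKT : is_KKT P xs ys zs).

Lemma KKT_edom : edom (ph P) xs.
Proof.
have [[v sv _] _ _] := hKKT; have [_ [w hw]] := ph_proper P.
have hle := le_lt_trans (sv w) hw; rewrite /edom /= ltey.
by apply: contraTneq hle => ->; rewrite addye// ltxx.
Qed.

(** Stationarity makes [xs] a minimizer of the convex function [lagrangian _ ys zs]; feasibility and
    complementarity make its value there the optimal objective. *)
Lemma KKT_lagrangian_ge u : edom (ph P) u ->
  g xs + hr xs <= lagrangian u ys zs.
Proof.
move=> hu; have [[v sv stat] Axs compl] := hKKT.
have hle : hr xs + dotp v (u - xs) <= hr u.
  have := sv u.
  rewrite -(edom_fineK (ph_proper P) hu).
  rewrite -(edom_fineK (ph_proper P) KKT_edom) -EFinD lee_fin; apply.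
have gle := convex_ge_tangent u (let: And3 c _ _ := pg_smooth P in c)
  (pg_differentiable P xs).
have fle : \sum_j zs j 0 * dotp (grad (f j) xs) (u - xs) <=
    \sum_j zs j 0 * f j u.
  apply: ler_sum => j _; have [z0 _ comp] := compl j.
  have := ler_wpM2l z0 (convex_ge_tangent u
    (let: And3 c _ _ := pf_smooth P j in c) (pf_differentiable P j xs)).
  by rewrite mulrDr comp add0r.
have := congr1 (fun e => dotp e (u - xs)) stat.
rewrite dotp0l !dotpDl dotp_trmx dotp_suml.
under eq_bigr do rewrite dotpZl.
rewrite /lagrangian mulmxBr -/A; rewrite -/A in Axs; rewrite Axs -/b.
move: hle gle fle; rewrite -/f -/g; lra.
Qed.

(** The bracket multiplied by [beta * (\sum_j B j * L j)] in [star_ineq]; it bounds the distance of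
    every iterate to [xs]. *)
Let M := norm2 (x 0%N - xs) + norm2 (y 0%N - ys) / Num.sqrt (rhoy * eta 0%N)
  + norm2 (z 0%N - zs) / Num.sqrt (rhoz * eta 0%N).

Let sqrt_ge0 := @sqrtr_ge0 R.

Lemma initial_distance_ge0 : 0 <= M.
Proof. by rewrite !addr_ge0 ?divr_ge0 ?norm2_ge0 ?sqrt_ge0. Qed.

Lemma KKT_distance k :
  norm2 (x k.+1 - xs) ^+ 2 + norm2 (z k.+1 - zs) ^+ 2 / (rhoz * eta k)
  <= M ^+ 2.
Proof.
have [_ Axs compl] := hKKT.
have fxs j : f j xs <= 0 by case: (compl j).
have zs0 j : 0 <= zs j 0 by case: (compl j).
have := LALM_sum k ys KKT_edom Axs fxs zs0.
have : 0 <= \sum_(t < k.+1)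
    (eta t)^-1 * (lagrangian (x t.+1) ys zs - (g xs + hr xs)).
  apply: sumr_ge0 => t _; rewrite mulr_ge0 ?invr_ge0 ?(ltW (eta_gt0 _))//.
  by rewrite subr_ge0 KKT_lagrangian_ge//; exact: iterate_edom.
have ek : eta k != 0 by rewrite gt_eqF ?eta_gt0.
have e0 : eta 0%N != 0 by rewrite gt_eqF.
have ry : rhoy != 0 by rewrite gt_eqF.
have rz : rhoz != 0 by rewrite gt_eqF.
have : 0 <= norm2 (y k.+1 - ys) ^+ 2 / (2 * rhoy) / eta k.
  by rewrite !divr_ge0 ?sqr_ge0 ?mulr_ge0// ltW// eta_gt0.
rewrite /energy [(_ + _) / eta k]mulrDl.
have -> : norm2 (z k.+1 - zs) ^+ 2 / (2 * rhoz) / eta k =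
  norm2 (z k.+1 - zs) ^+ 2 / (rhoz * eta k) / 2 by field; apply/andP.
have sy := sqr_sqrtr (ltW (mulr_gt0 rhoy0 heta0)).
have sz := sqr_sqrtr (ltW (mulr_gt0 rhoz0 heta0)).
have -> : (norm2 (y 0%N - ys) ^+ 2 / (2 * rhoy) +
    norm2 (z 0%N - zs) ^+ 2 / (2 * rhoz)) / eta 0%N =
  ((norm2 (y 0%N - ys) / Num.sqrt (rhoy * eta 0%N)) ^+ 2 +
   (norm2 (z 0%N - zs) / Num.sqrt (rhoz * eta 0%N)) ^+ 2) / 2.
  by rewrite !expr_div_n sy sz; field; rewrite e0 ry rz.
(* A sum of squares of nonnegative numbers is at most the square of their sum. *)
rewrite /M; move: (norm2_ge0 (x 0%N - xs)).
have : 0 <= norm2 (y 0%N - ys) / Num.sqrt (rhoy * eta 0%N).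
  by rewrite divr_ge0 ?norm2_ge0 ?sqrt_ge0.
have : 0 <= norm2 (z 0%N - zs) / Num.sqrt (rhoz * eta 0%N).
  by rewrite divr_ge0 ?norm2_ge0 ?sqrt_ge0.
set n1 := norm2 _; set n2 := _ / Num.sqrt _; set n3 := _ / Num.sqrt _.
move=> n30 n20 n10; have := mulr_ge0 n30 n20; have := mulr_ge0 n30 n10.
by have := mulr_ge0 n20 n10; lra.
Qed.

Lemma primal_distance k : norm2 (x k - xs) <= M.
Proof.
case: k => [|k].
  rewrite /M -addrA lerDl.
  by rewrite addr_ge0 ?divr_ge0 ?norm2_ge0 ?sqrt_ge0.
rewrite -ler_sqr ?nnegrE ?norm2_ge0 ?initial_distance_ge0//.
apply: le_trans (KKT_distance k); rewrite lerDl.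
by rewrite divr_ge0 ?sqr_ge0 ?mulr_ge0 ?(ltW (eta_gt0 _)) ?(ltW rhoz0).
Qed.

(** The index matters: [z k.+1] is controlled by [eta k], so the bound on [eta k.+1] can be proved
    by induction. *)
Lemma dual_distance k :
  norm2 (z k.+1 - zs) <= Num.sqrt (rhoz * eta k) * M.
Proof.
have re : 0 < rhoz * eta k by rewrite mulr_gt0 ?eta_gt0.
rewrite -ler_sqr ?nnegrE ?norm2_ge0 ?mulr_ge0 ?initial_distance_ge0//.
rewrite exprMn (sqr_sqrtr (ltW re)) mulrC -ler_pdivrMr//.
by apply: le_trans (KKT_distance k); rewrite lerDr sqr_ge0.
Qed.

Let c0 := delta + Lg + beta * spectral_norm A ^+ 2 + beta * \sum_j B j ^+ 2
  + beta * (\sum_j B j * L j) * M.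
Let sL := Num.sqrt (\sum_j L j ^+ 2).

(** As [f j xs <= 0], the tangent at [x k] gives [f j (x k) <= B j * M]; Cauchy-Schwarz controls the
    remaining sum of [L j * z k j 0]. *)
Lemma LF_bound k d : norm2 (z k - zs) <= d ->
  LF P Lg L B beta (x k) (z k) + delta <= c0 + sL * (norm2 zs + d).
Proof.
have [_ L0 _ _ gradB] := hlip; have [_ _ compl] := hKKT.
move=> zd.
have B0 j : 0 <= B j by exact: le_trans (norm2_ge0 _) (gradB j _ hx0).
have fle j : f j (x k) <= B j * M.
  have [_ fxs _] := compl j.
  have := convex_ge_tangent xs (let: And3 c _ _ := pf_smooth P j in c)
    (pf_differentiable P j (x k)).
  rewrite -(opprB (x k)) dotpNr.
  have := dotp_le (grad (pf P j) (x k)) (x k - xs).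
  have := ler_wpM2r (norm2_ge0 (x k - xs)) (gradB j _ (iterate_edom k)).
  have := ler_wpM2l (B0 j) (primal_distance k).
  by move: fxs; rewrite -/f; lra.
have Lz : \sum_j L j * z k j 0 <= sL * (norm2 zs + d).
  apply: (@le_trans _ _ (sL * norm2 (z k))).
    have -> : sL = norm2 (\col_j L j).
      by congr Num.sqrt; apply: eq_bigr => j _; rewrite mxE expr2.
    apply: le_trans (dotp_le _ _); rewrite le_eqVlt; apply/orP; left.
    by apply/eqP/eq_bigr => j _; rewrite mxE.
  rewrite ler_wpM2l ?sqrt_ge0//.
  by have := norm2D zs (z k - zs); rewrite addrC subrK; lra.
have sumle : \sum_j (beta * B j ^+ 2 +
    L j * pospart (beta * pf P j (x k) + z k j 0)) <=
    beta * \sum_j B j ^+ 2 + beta * (\sum_j B j * L j) * M +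
    \sum_j L j * z k j 0.
  rewrite !mulr_sumr mulr_suml -!big_split; apply: ler_sum => j _ /=.
  rewrite -addrA lerD2l.
  have : pospart (beta * pf P j (x k) + z k j 0) <= beta * (B j * M) + z k j 0.
    rewrite /pospart ge_max addr_ge0 ?multiplier_ge0//=; last first.
      by rewrite mulr_ge0 ?mulr_ge0 ?initial_distance_ge0// ltW.
    by rewrite lerD2r ler_pM2l.
  by move=> /(ler_wpM2l (L0 j)); lra.
by rewrite /LF /c0 -/A; lra.
Qed.

Lemma eta_le K : c0 + sL * (norm2 zs + norm2 (z 0%N - zs)) <= K ->
  c0 + sL * (norm2 zs + Num.sqrt (rhoz * K) * M) <= K ->
  forall k, eta k <= K.
Proof.
move=> K0 K1; elim=> [|k IH].
  have := LF_bound (lexx (norm2 (z 0%N - zs))).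
  (* Positivity of [eta 0] rules out that the maximum with [0] is attained at [0]. *)
  have := heta0; rewrite (LALM_eta hLALM 0).
  by case: (lerP 0 (LF P Lg L B beta (x 0%N) (z 0%N) + delta)) => //; lra.
rewrite (LALM_eta hLALM k.+1) ge_max IH /=; apply: le_trans K1.
apply: le_trans (LF_bound (dual_distance k)) _.
rewrite lerD2l ler_wpM2l ?sqrt_ge0// lerD2l ler_wpM2r ?initial_distance_ge0//.
by rewrite ler_wsqrtr// ler_pM2l.
Qed.

(** The two entries of the [Num.max] in [star_ineq] match the two hypotheses of [eta_le]: [1] for
    the base case, the square root for the induction step. *)
Lemma eta_le_star etabar :
  star_ineq P Lg L B beta rhoy rhoz delta
    (x 0%N) (y 0%N) (z 0%N) (eta 0%N) xs ys zs etabar ->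
  forall k, eta k <= etabar.
Proof.
rewrite /star_ineq -/A -/M -/c0 -/sL => star.
have my : Num.sqrt (rhoz * etabar / (rhoy * eta 0%N)) =
    Num.sqrt (rhoz * etabar) / Num.sqrt (rhoy * eta 0%N).
  rewrite mulrC sqrtrM ?invr_ge0 ?mulr_ge0 ?ltW//.
  by rewrite sqrtrV ?mulr_ge0 ?ltW// mulrC.
have mz : Num.sqrt (etabar / eta 0%N) =
    Num.sqrt (rhoz * etabar) / Num.sqrt (rhoz * eta 0%N).
  have -> : etabar / eta 0%N = (rhoz * eta 0%N)^-1 * (rhoz * etabar).
    by field; rewrite !gt_eqF.
  by rewrite sqrtrM ?invr_ge0 ?mulr_ge0 ?ltW// sqrtrV ?mulr_ge0 ?ltW// mulrC.
have sL0 : 0 <= sL by exact: sqrt_ge0.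
have max1 : norm2 (z 0%N - zs) <=
    Num.max 1 (Num.sqrt (etabar / eta 0%N)) * norm2 (z 0%N - zs).
  by rewrite ler_peMl ?norm2_ge0// le_max lexx.
have max2 : Num.sqrt (etabar / eta 0%N) * norm2 (z 0%N - zs) <=
    Num.max 1 (Num.sqrt (etabar / eta 0%N)) * norm2 (z 0%N - zs).
  by rewrite ler_wpM2r ?norm2_ge0// le_max lexx orbT.
have n1 : 0 <= Num.sqrt (rhoz * etabar) * norm2 (x 0%N - xs).
  by rewrite mulr_ge0 ?norm2_ge0 ?sqrt_ge0.
have n2 : 0 <= Num.sqrt (rhoz * etabar / (rhoy * eta 0%N)) *
    norm2 (y 0%N - ys) by rewrite mulr_ge0 ?norm2_ge0 ?sqrt_ge0.
apply: eta_le; apply: le_trans star; rewrite lerD2l ler_wpM2l//.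
  by lra.
by move: max2; rewrite mz my /M; lra.
Qed.

(** Convergence of [eta] must not presuppose a solution of [star_ineq]. A bound exists anyway,
    because the right-hand side grows only like the square root of [K]. *)
Lemma eta_bounded : exists K, forall k, eta k <= K.
Proof.
set C0 := c0 + sL * (norm2 zs + norm2 (z 0%N - zs)).
set C1 := sL * Num.sqrt rhoz * M.
have C10 : 0 <= C1.
  by rewrite mulr_ge0 ?initial_distance_ge0// mulr_ge0 ?sqrt_ge0.
(* With [K = S ^+ 2] the condition becomes [C0 + C1 * S <= S ^+ 2], which holds as [S >= 1] and
   [S >= |C0| + C1]. *)
pose S := `|C0| + C1 + 1.
have nC0 := ler_norm C0; have nC00 := normr_ge0 C0.
have S1 : 1 <= S by rewrite /S; lra.
have C0S : C0 <= `|C0| * S by rewrite (le_trans nC0)// ler_peMr.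
have C1S : 0 <= C1 * S by rewrite mulr_ge0//; lra.
have S2 : `|C0| * S + C1 * S <= S ^+ 2.
  by rewrite expr2 -mulrDl ler_wpM2r /S; lra.
exists (S ^+ 2); apply: eta_le; first by rewrite -/C0; lra.
rewrite sqrtrM ?(ltW rhoz0)// sqrtr_sqr ger0_norm; last by lra.
have : 0 <= sL * norm2 (z 0%N - zs) by rewrite mulr_ge0 ?norm2_ge0 ?sqrt_ge0.
have -> : c0 + sL * (norm2 zs + Num.sqrt rhoz * S * M) =
  C0 - sL * norm2 (z 0%N - zs) + C1 * S by rewrite /C0 /C1; ring.
lra.
Qed.

Lemma eta_nondecreasing : nondecreasing_seq eta.
Proof. by apply/nondecreasing_seqP => k; exact: eta_mono. Qed.

Lemma eta_cvg : cvgn eta.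
Proof.
have [K etaK] := eta_bounded.
apply: nondecreasing_is_cvgn eta_nondecreasing _.
by exists K => _ [k _ <-]; exact: etaK.
Qed.

Lemma eta_le_lim k : eta k <= limn eta.
Proof. exact: nondecreasing_cvgn_le eta_nondecreasing eta_cvg k. Qed.

(** * Convergence rates *)

Context (hy0 : y 0%N = 0).

Let KKT_ergodic k v w : (forall j, 0 <= w j 0) ->
  lagrangian (ergodic eta x k) v w - (g xs + hr xs) <=
  limn eta / (eta 0%N * k.+1%:R) * (eta 0%N / 2 * norm2 (x 0%N - xs) ^+ 2
    + norm2 v ^+ 2 / (2 * rhoy) + norm2 w ^+ 2 / (2 * rhoz)).
Proof.
move=> w0; have [_ Axs compl] := hKKT.
apply: ergodic_lagrangian => //; first exact: KKT_edom.
  by move=> j; case: (compl j).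
exact: eta_le_lim.
Qed.

Let rate_ge0 k : 0 <= limn eta / (eta 0%N * k.+1%:R).
Proof.
rewrite divr_ge0 ?mulr_ge0 ?(ltW heta0)//.
exact: le_trans (ltW heta0) (eta_le_lim 0).
Qed.

(** Zero multipliers give the upper side. For the lower side, let [d] be the optimal value minus the
    objective at the average. [KKT_lagrangian_ge] bounds the multiplier terms below by [d], so the
    gap at doubled multipliers is at least [- d + 2 * d = d]. *)
Lemma KKT_objective_bound k :
  (`| f0 P (ergodic eta x k) - f0 P xs | <=
    (limn eta / (eta 0%N * k.+1%:R)
     * (eta 0%N / 2 * norm2 (x 0%N - xs) ^+ 2
        + 2 * norm2 ys ^+ 2 / rhoy + \sum_j 2 * zs j 0 ^+ 2 / rhoz))%:E)%E.
Proof.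
set xk := ergodic eta x k; have hxk : edom (ph P) xk := ergodic_edom k.
rewrite /f0 -(edom_fineK (ph_proper P) hxk).
rewrite -(edom_fineK (ph_proper P) KKT_edom).
rewrite -!EFinD lee_fin -/(hr _) -/(hr _) -/g.
have [_ _ compl] := hKKT.
have zs0 j : 0 <= zs j 0 by case: (compl j).
have w00 : forall j, 0 <= (0 : 'cV[R]_m) j 0 by move=> j; rewrite mxE.
have w20 : forall j, 0 <= (2 *: zs) j 0 by move=> j; rewrite mxE mulr_ge0.
have := KKT_ergodic k 0 w00; have := KKT_ergodic k (2 *: ys) w20.
have := KKT_lagrangian_ge hxk.
rewrite /lagrangian -/xk !norm2Z !norm2_0 dotpZl dotp0l normr_nat.
under [X in _ -> _ -> _ + X - _ <= _ -> _]eq_bigr do rewrite mxE mul0r.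
rewrite big1_eq.
have -> : \sum_j (2 *: zs) j 0 * f j xk = 2 * \sum_j zs j 0 * f j xk.
  by rewrite mulr_sumr; apply: eq_bigr => j _; rewrite mxE mulrA.
have -> : \sum_j 2 * zs j 0 ^+ 2 / rhoz = 2 * norm2 zs ^+ 2 / rhoz.
  rewrite norm2_sqr mulr_sumr mulr_suml; apply: eq_bigr => j _.
  by rewrite expr2.
have rz : rhoz != 0 by rewrite gt_eqF.
have ry : rhoy != 0 by rewrite gt_eqF.
set rate := _ / (_ * _).
have -> : (2 * norm2 ys) ^+ 2 / (2 * rhoy) = 2 * norm2 ys ^+ 2 / rhoy by field.
have -> : (2 * norm2 zs) ^+ 2 / (2 * rhoz) = 2 * norm2 zs ^+ 2 / rhoz by field.
have : 0 <= rate * (2 * norm2 ys ^+ 2 / rhoy).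
  by rewrite mulr_ge0 ?rate_ge0// divr_ge0 ?(ltW rhoy0)// mulr_ge0 ?sqr_ge0.
have : 0 <= rate * (2 * norm2 zs ^+ 2 / rhoz).
  by rewrite mulr_ge0 ?rate_ge0// divr_ge0 ?(ltW rhoz0)// mulr_ge0 ?sqr_ge0.
rewrite expr0n !mul0r !addr0 !mulrDr => z2 y2 KKT le2 le0.
by rewrite ler_norml; apply/andP; split; lra.
Qed.

(** Perturbing the KKT multipliers by a unit vector along the residual and by indicators of
    violation adds exactly the infeasibility to the Lagrangian; [KKT_lagrangian_ge] removes the
    rest. *)
Lemma KKT_feasibility_bound k :
  norm2 (A *m ergodic eta x k - b)
    + \sum_j pospart (f j (ergodic eta x k)) <=
  limn eta / (eta 0%N * k.+1%:R)
  * (eta 0%N / 2 * norm2 (x 0%N - xs) ^+ 2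
     + (1 + norm2 ys) ^+ 2 / (2 * rhoy)
     + \sum_j (1 + zs j 0) ^+ 2 / (2 * rhoz)).
Proof.
set xk := ergodic eta x k; have hxk : edom (ph P) xk := ergodic_edom k.
have [_ _ compl] := hKKT.
have zs0 j : 0 <= zs j 0 by case: (compl j).
set r := A *m xk - b.
(* If [r = 0], the inverse of [0] is [0] and [v = ys], so no case split is needed here. *)
pose v := ys + (norm2 r)^-1 *: r.
pose w : 'cV[R]_m := \col_j (zs j 0 + (0 < f j xk)%R%:R).
have w0 j : 0 <= w j 0 by rewrite mxE addr_ge0.
have := KKT_ergodic k v w0; have := KKT_lagrangian_ge hxk.
rewrite /lagrangian -/xk -/r.
have -> : dotp v r = dotp ys r + norm2 r.
  rewrite dotpDl dotpZl -norm2_sqr; congr (_ + _).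
  have [->|r0] := eqVneq (norm2 r) 0; first by rewrite invr0 mul0r.
  by rewrite expr2 mulKf.
have -> : \sum_j w j 0 * f j xk =
    \sum_j zs j 0 * f j xk + \sum_j pospart (f j xk).
  rewrite -big_split; apply: eq_bigr => j _ /=; rewrite mxE mulrDl /pospart.
  by case: (ltrP 0 (f j xk)); rewrite ?mul1r ?mul0r.
have vle : norm2 v ^+ 2 / (2 * rhoy) <= (1 + norm2 ys) ^+ 2 / (2 * rhoy).
  rewrite ler_wpM2r ?invr_ge0 ?mulr_ge0 ?(ltW rhoy0)//.
  rewrite ler_sqr ?nnegrE ?addr_ge0 ?norm2_ge0// addrC.
  apply: le_trans (norm2D _ _) _; rewrite lerD2l norm2Z.
  rewrite ger0_norm ?invr_ge0 ?norm2_ge0//.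
  have [->|r0] := eqVneq (norm2 r) 0; first by rewrite mulr0.
  by rewrite mulVf.
have wle : norm2 w ^+ 2 / (2 * rhoz) <= \sum_j (1 + zs j 0) ^+ 2 / (2 * rhoz).
  rewrite -mulr_suml ler_wpM2r ?invr_ge0 ?mulr_ge0 ?(ltW rhoz0)//.
  rewrite norm2_sqr; apply: ler_sum => j _; rewrite -expr2 mxE addrC.
  rewrite ler_sqr ?nnegrE ?addr_ge0// lerD2r.
  by case: (0 < f j xk).
have := ler_wpM2l (rate_ge0 k) (lerD vle wle).
by set rate := limn eta / _; lra.
Qed.

End LALM.

Theorem theorem3p3 (R : realType) (p q m : nat) (P : program R p q m)
    (Lg : R) (L B : 'I_m -> R) (beta rhoy rhoz delta : R)
    (xs : 'cV[R]_p) (ys : 'cV[R]_q) (zs : 'cV[R]_m)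
    (x : nat -> 'cV[R]_p) (y : nat -> 'cV[R]_q) (z : nat -> 'cV[R]_m)
    (eta : nat -> R)
    (hlip : lipschitz_bounded P Lg L B)
    (hKKT : is_KKT P xs ys zs)
    (hbeta : 0 < beta) (hdelta : 0 <= delta)
    (hrhoy : 0 < rhoy <= beta) (hrhoz : 0 < rhoz <= beta)
    (hLALM : is_LALM P Lg L B beta rhoy rhoz delta x y z eta)
    (hx0 : edom (ph P) (x 0%N)) (hy0 : y 0%N = 0) (hz0 : z 0%N = 0)
    (heta0 : 0 < eta 0%N) :
  [/\ cvgn eta,
      forall etabar : R,
        star_ineq P Lg L B beta rhoy rhoz delta
          (x 0%N) (y 0%N) (z 0%N) (eta 0%N) xs ys zs etabar ->
        limn eta <= etabar
    & forall k : nat,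
        (`| f0 P (ergodic eta x k) - f0 P xs | <=
          (limn eta / (eta 0%N * k.+1%:R)
           * (eta 0%N / 2 * norm2 (x 0%N - xs) ^+ 2
              + 2 * norm2 ys ^+ 2 / rhoy
              + \sum_j 2 * zs j 0 ^+ 2 / rhoz))%:E)%E /\
        norm2 (pA P *m ergodic eta x k - pb P)
          + \sum_j pospart (pf P j (ergodic eta x k)) <=
        limn eta / (eta 0%N * k.+1%:R)
        * (eta 0%N / 2 * norm2 (x 0%N - xs) ^+ 2
           + (1 + norm2 ys) ^+ 2 / (2 * rhoy)
           + \sum_j (1 + zs j 0) ^+ 2 / (2 * rhoz))].
Proof.
have limle := eta_le_lim hlip hbeta hdelta hrhoy hrhoz hLALM hx0 hz0 heta0 hKKT.
split.
- exact: (eta_cvg hlip hbeta hdelta hrhoy hrhoz hLALM hx0 hz0 heta0 hKKT).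
- move=> etabar star; apply: limr_le.
    exact: (eta_cvg hlip hbeta hdelta hrhoy hrhoz hLALM hx0 hz0 heta0 hKKT).
  apply: nearW => k.
  exact: (eta_le_star hlip hbeta hdelta hrhoy hrhoz hLALM hx0 hz0 heta0
    hKKT star).
- move=> k; split.
    exact: (KKT_objective_bound hlip hbeta hdelta hrhoy hrhoz hLALM hx0 hz0
      heta0 hKKT hy0).
  exact: (KKT_feasibility_bound hlip hbeta hdelta hrhoy hrhoz hLALM hx0 hz0
    heta0 hKKT hy0).
Qed.
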